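(* Let $f:\mathbb{R}^n\times[0,\infty)\to\mathbb{R}^n$ be continuous and let $s:[0,\infty)\to\mathbb{R}^n$ be a solution of $\dot s(t)=f(s(t),t)$. Let $A=(a_{ij})\in\mathbb{R}^{m\times m}$ be symmetric with $a_{ij}\ge 0$ for $i\neq j$ and $\sum_{j=1}^m a_{ij}=0$ for all $i$. Let $c>0$, $\varepsilon>0$, let $\tilde A$ be the matrix obtained from $A$ by replacing $a_{11}$ by $a_{11}-\varepsilon$, and suppose that $0>\lambda_1>\cdots>\lambda_m$ are the eigenvalues of $\tilde A$. Let $g:\mathbb{R}\to\mathbb{R}$ be a monotone increasing function with $\frac{g(u)-g(v)}{u-v}\ge\underline{\alpha}>0$ for all $u\neq v$, where $\underline{\alpha}$ is a constant. If there are positive diagonal matrices $P=\operatorname{diag}\{p_1,\dots,p_n\}$, $\Delta=\operatorname{diag}\{\Delta_1,\dots,\Delta_n\}$ and a constant $\eta>0$ such that $$(x-y)^{\top}P\big(f(x,t)-\Delta x-f(y,t)+\Delta y\big)\le-\eta\,(x-y)^{\top}(x-y)\qquad\text{for all }x,y\in\mathbb{R}^n,\ t\ge 0,$$ and $\Delta_k+\underline{\alpha}c\lambda_1<0$ for $k=1,\dots,n$, then the nonlinearly coupled controlled network $$\dot x_1=f(x_1,t)+c\sum_{j=1}^m a_{1j}g(x_j)-c\varepsilon\big(g(x_1)-g(s(t))\big),\qquad \dot x_i=f(x_i,t)+c\sum_{j=1}^m a_{ij}g(x_j)\quad(i=2,\dots,m),$$ is globally exponentially synchronized to $s(t)$.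
   Context: Here $x_i(t)=[x_i^1(t),\dots,x_i^n(t)]^{\top}\in\mathbb{R}^n$ is the state of node $i$, $c$ is the coupling strength, and for a vector $x=[x^1,\dots,x^n]^{\top}$, $g(x)=[g(x^1),\dots,g(x^n)]^{\top}$ (componentwise application). ''Globally exponentially synchronized to $s(t)$'' means: there is a constant $\gamma>0$ such that for every solution $(x_1,\dots,x_m)$ of the controlled network on $[0,\infty)$ (with arbitrary initial values), $\|x_i(t)-s(t)\|=O(e^{-\gamma t})$ as $t\to\infty$ for all $i=1,\dots,m$. *)

(* Defs.v *)
From mathcomp Require Import all_boot all_order all_algebra.
From mathcomp Require Import all_classical all_reals all_analysis.
Import Order.TTheory GRing.Theory Num.Theory.
Import numFieldNormedType.Exports.

Set Implicit Arguments.
Unset Strict Implicit.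
Unset Printing Implicit Defensive.

Local Open Scope classical_set_scope.
Local Open Scope ring_scope.

(* The difference quotient is taken over times u >= 0 only: this is the usual
   derivative at t > 0 and the right derivative at t = 0. Values of x at
   negative times play no role. *)
Definition has_derivative_at (R : realType) (n : nat)
    (x : R -> 'cV[R]_n) (t : R) (v : 'cV[R]_n) : Prop :=
  (u - t)^-1 *: (x u - x t) @[u --> within `[0, +oo[ t^'] --> v.

Definition is_solution (R : realType) (n : nat)
    (f : 'cV[R]_n -> R -> 'cV[R]_n) (x : R -> 'cV[R]_n) : Prop :=
  forall t, 0 <= t -> has_derivative_at x t (f (x t) t).

(* Nodes are numbered from 0; ord0 is the controlled one. *)
Definition pinned_matrix (R : realType) (m : nat)
    (A : 'M[R]_m.+1) (eps : R) : 'M[R]_m.+1 :=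
  \matrix_(i, j) (if (i == ord0) && (j == ord0) then A i j - eps else A i j).

Definition network_field (R : realType) (n m : nat)
    (f : 'cV[R]_n -> R -> 'cV[R]_n) (A : 'M[R]_m.+1) (c eps : R) (g : R -> R)
    (s : R -> 'cV[R]_n) (X : 'I_m.+1 -> 'cV[R]_n) (t : R) (i : 'I_m.+1) :
    'cV[R]_n :=
  let coupled := f (X i) t + c *: \sum_j A i j *: map_mx g (X j) in
  if i == ord0 then
    coupled - (c * eps) *: (map_mx g (X i) - map_mx g (s t))
  else coupled.

Definition is_network_solution (R : realType) (n m : nat)
    (f : 'cV[R]_n -> R -> 'cV[R]_n) (A : 'M[R]_m.+1) (c eps : R) (g : R -> R)
    (s : R -> 'cV[R]_n) (x : 'I_m.+1 -> R -> 'cV[R]_n) : Prop :=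
  forall t, 0 <= t -> forall i,
    has_derivative_at (x i) t (network_field f A c eps g s (x ^~ t) t i).

(* The rate gamma is uniform over all solutions; the constant C of the bound
   O(exp(- gamma t)) may depend on the solution. *)
Definition globally_exp_synchronized (R : realType) (n m : nat)
    (solution : ('I_m.+1 -> R -> 'cV[R]_n) -> Prop) (s : R -> 'cV[R]_n) : Prop :=
  exists2 gamma : R, 0 < gamma &
    forall x, solution x -> forall i,
      exists2 C : R, 0 < C &
        \forall t \near +oo, `|x i t - s t| <= C * expR (- gamma * t).

(* Main.v *)
(* Take the Lyapunov function V = sum_(i,k) p_k (x_i^k - s^k)^2. Writing
   e_i = x_i - s and using the zero row sums of A, the error satisfies
   e_i' = f(x_i) - f(s) + c sum_j At_ij (g(x_j) - g(s)), where At is the pinned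
   matrix. In each coordinate k, g - alpha id is nondecreasing and A is a
   Laplacian, so the coupling term e^T At (g(x) - g(s)) is at most
   alpha e^T At e <= alpha lambda_1 |e|^2; the last inequality comes from an
   orthogonal eigenbasis, available because At is symmetric with as many distinct
   eigenvalues as rows. The gain condition makes the coupling absorb the term
   Delta, hence V' <= - 2 eta |e|^2 <= - r V and V decays exponentially. *)
Require Import Defs.
From mathcomp Require Import all_boot all_order all_algebra.
From mathcomp Require Import all_classical all_reals all_analysis.
From mathcomp Require Import ring lra.
Import Order.TTheory GRing.Theory Num.Theory.
Import numFieldNormedType.Exports.
Local Open Scope classical_set_scope.
Local Open Scope ring_scope.

(** * Quadratic forms of symmetric matrices and of Laplacians *)

Lemma dot_rowE (F : comRingType) (n : nat) (v w : 'rV[F]_n) :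
  (v *m w^T) ord0 ord0 = \sum_i v ord0 i * w ord0 i.
Proof. by rewrite mxE; apply: eq_bigr => i _; rewrite mxE. Qed.

(** Eigenvectors of a symmetric matrix for distinct eigenvalues are orthogonal, so n of them form a
    basis that diagonalizes the form. They are left unnormalized, which avoids square roots over a
    mere [realFieldType]. *)
Lemma sym_quad_form_le (F : realFieldType) (n : nat) (M : 'M[F]_n)
    (mu : 'I_n -> F) (l : F) (w : 'rV[F]_n) :
  M^T = M -> injective mu -> (forall i, eigenvalue M (mu i)) ->
  (forall i, mu i <= l) ->
  (w *m M *m w^T) ord0 ord0 <= l * (w *m w^T) ord0 ord0.
Proof.
move=> Msym mu_inj mu_eigen mu_le.
have /fin_all_exists [v vP] i :
    exists v : 'rV[F]_n, v *m M = mu i *: v /\ v != 0.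
  by have /eigenvalueP[v vM v0] := mu_eigen i; exists v.
(* The rows of V are orthogonal eigenvectors, N collects their squared norms. *)
pose V : 'M[F]_n := \matrix_i v i.
pose N : 'rV[F]_n := \row_i (v i *m (v i)^T) ord0 ord0.
have orth i j : i != j -> v i *m (v j)^T = 0.
  move=> ij; have : mu i *: (v i *m (v j)^T) = mu j *: (v i *m (v j)^T).
    rewrite scalemxAl -(vP i).1 -{1}Msym -mulmxA -trmx_mul (vP j).1.
    by rewrite linearZ /= -scalemxAr.
  move/eqP; rewrite -subr_eq0 -scalerBl scaler_eq0 subr_eq0 => /orP[/eqP muE|].
    by rewrite (mu_inj _ _ muE) eqxx in ij.
  by move/eqP.
have VM : V *m M = diag_mx (\row_i mu i) *m V.
  apply/row_matrixP => i; rewrite row_mul rowK (vP i).1.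
  by apply/rowP => j; rewrite mul_diag_mx !mxE.
have VV : V *m V^T = diag_mx N.
  apply/matrixP => i j.
  have -> : (V *m V^T) i j = (v i *m (v j)^T) ord0 ord0.
    by rewrite !mxE; apply: eq_bigr => k _; rewrite !mxE.
  rewrite [RHS]mxE; case: eqVneq => [->|/orth ->]; first by rewrite mulr1n [RHS]mxE.
  by rewrite mulr0n mxE.
have N_gt0 i : 0 < N ord0 i.
  rewrite mxE dot_rowE lt_def.
  have sq_ge0 k : true -> 0 <= v i ord0 k * v i ord0 k by rewrite -expr2 sqr_ge0.
  rewrite sumr_ge0// andbT; apply: contra (vP i).2 => /eqP v0.
  apply/eqP/rowP => k; rewrite mxE; apply/eqP.
  by have /(_ k isT)/eqP := psumr_eq0P sq_ge0 v0; rewrite mulf_eq0 orbb.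
(* If [V] were singular, the determinant of [V *m V^T], which is the product of the positive entries
   of [N], would vanish. *)
have Vunit : V \in unitmx.
  rewrite unitmxE unitfE; apply: contraTneq isT => detV.
  have : \det (V *m V^T) = 0 by rewrite det_mulmx detV mul0r.
  rewrite VV det_diag => /eqP/prodf_eq0[i _ /eqP Ni].
  by have := N_gt0 i; rewrite Ni ltxx.
clearbody N; pose y := w *m invmx V.
have wE : w = y *m V by rewrite mulmxKV.
(* In the coordinates [y] both forms are diagonal, and the terms mu_i N_i y_i^2 and l N_i y_i^2 are
   compared one by one. *)
clearbody y; rewrite wE trmx_mul -(mulmxA y V M) VM !mulmxA -!(mulmxA _ V V^T) VV.
rewrite !dot_rowE mulr_sumr; apply: ler_sum => i _.
rewrite !mul_mx_diag !mxE.
have l_ge0 : 0 <= l - mu i by rewrite subr_ge0.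
have N_gt0' : 0 < N 0 i := N_gt0 i.
have := mulr_ge0 (mulr_ge0 (ltW N_gt0') (sqr_ge0 (y ord0 i))) l_ge0.
lra.
Qed.

(* Summation by parts: the form equals
   - 1/2 sum_(i,j) A_ij (e_i - e_j) (h_i - h_j). *)
Lemma laplacian_monotone_form_le0 (F : realFieldType) (n : nat) (A : 'M[F]_n)
    (e h : 'I_n -> F) :
  A^T = A -> (forall i j, i != j -> 0 <= A i j) ->
  (forall i, \sum_j A i j = 0) ->
  (forall i j, 0 <= (e i - e j) * (h i - h j)) ->
  \sum_i e i * \sum_j A i j * h j <= 0.
Proof.
move=> Asym Aoff Arow mono.
have AC i j : A i j = A j i by rewrite -{1}Asym mxE.
set S := \sum_i _.
(* Expanding the product gives four sums: the two pure ones vanish by the zero row sums and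
   symmetry, the two mixed ones both equal [S]. *)
have -> : S = - (\sum_i \sum_j A i j * ((e i - e j) * (h i - h j))) / 2.
  have diag : \sum_i \sum_j A i j * (e i * h i) = 0.
    by rewrite big1// => i _; rewrite -mulr_suml Arow mul0r.
  have cross : \sum_i \sum_j A i j * (e i * h j) = S.
    apply: eq_bigr => i _; rewrite mulr_sumr.
    by apply: eq_bigr => j _; rewrite mulrCA.
  have diag' : \sum_i \sum_j A i j * (e j * h j) = 0.
    rewrite exchange_big -[RHS]diag; apply: eq_bigr => i _.
    by apply: eq_bigr => j _; rewrite AC.
  have cross' : \sum_i \sum_j A i j * (e j * h i) = S.
    rewrite exchange_big -[RHS]cross; apply: eq_bigr => i _.
    by apply: eq_bigr => j _; rewrite AC.
  have -> : \sum_i \sum_j A i j * ((e i - e j) * (h i - h j)) =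
      \sum_i \sum_j A i j * (e i * h i) - \sum_i \sum_j A i j * (e i * h j)
      - \sum_i \sum_j A i j * (e j * h i) + \sum_i \sum_j A i j * (e j * h j).
    rewrite -!sumrB -big_split; apply: eq_bigr => i _.
    rewrite -!sumrB -big_split; apply: eq_bigr => j _ /=; ring.
  rewrite diag diag' cross cross'; lra.
rewrite mulNr oppr_le0 divr_ge0// sumr_ge0// => i _; rewrite sumr_ge0// => j _.
have [->|ij] := eqVneq i j; first by rewrite subrr mul0r mulr0.
by rewrite mulr_ge0// Aoff.
Qed.

(** * Coupling through the pinned matrix *)

Lemma pinned_sum (R : realType) (m : nat) (A : 'M[R]_m.+1) (eps : R)
    (h : 'I_m.+1 -> R) (i : 'I_m.+1) :
  \sum_j pinned_matrix A eps i j * h j =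
  \sum_j A i j * h j - (if i == ord0 then eps * h ord0 else 0).
Proof.
rewrite big_ord_recl [in RHS]big_ord_recl !mxE eqxx andbT.
under eq_bigr do rewrite mxE andbF.
by case: ifP => _; ring.
Qed.

(** Since [g] acts componentwise, the coupling can be estimated one coordinate at a time; [y] stands
    for that coordinate of the target s(t). *)
Lemma pinned_coupling_le (R : realType) (m : nat) (A : 'M[R]_m.+1) (eps : R)
    (lambda : 'I_m.+1 -> R) (l alpha : R) (g : R -> R) (x : 'I_m.+1 -> R) (y : R) :
  A^T = A -> (forall i j, i != j -> 0 <= A i j) ->
  (forall i, \sum_j A i j = 0) -> 0 <= eps ->
  injective lambda ->
  (forall i, eigenvalue (pinned_matrix A eps) (lambda i)) ->
  (forall i, lambda i <= l) -> 0 <= alpha ->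
  (forall u v, alpha * (u - v) ^+ 2 <= (u - v) * (g u - g v)) ->
  \sum_i (x i - y) * \sum_j pinned_matrix A eps i j * (g (x j) - g y)
  <= alpha * l * \sum_i (x i - y) ^+ 2.
Proof.
move=> Asym Aoff Arow eps0 l_inj l_eigen l_le alpha0 g_mono.
have Msym : (pinned_matrix A eps)^T = pinned_matrix A eps.
  by apply/matrixP => i j; rewrite !mxE andbC -{1 2}Asym mxE.
pose e i := x i - y.
pose h i := (g (x i) - g y) - alpha * e i.
(* [h] comes from the nondecreasing function [g - alpha id], so that only the
   linear part of the coupling remains besides two nonpositive terms. *)
have -> : \sum_i (x i - y) * \sum_j pinned_matrix A eps i j * (g (x j) - g y) =
    \sum_i e i * (\sum_j A i j * h j) - eps * (e ord0 * h ord0)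
    + alpha * \sum_i e i * \sum_j pinned_matrix A eps i j * e j.
  have -> : \sum_i e i * (\sum_j A i j * h j) - eps * (e ord0 * h ord0) =
      \sum_i e i * \sum_j pinned_matrix A eps i j * h j.
    under [RHS]eq_bigr do rewrite pinned_sum mulrBr.
    rewrite sumrB; congr (_ - _); rewrite big_ord_recl big1/=.
      by rewrite addr0 mulrCA.
    by move=> i _; rewrite mulr0.
  rewrite mulr_sumr -big_split; apply: eq_bigr => i _ /=.
  rewrite mulrCA -mulrDr; congr (_ * _).
  by rewrite mulr_sumr -big_split; apply: eq_bigr => j _ /=; rewrite /h; ring.
have mono i j : 0 <= (e i - e j) * (h i - h j).
  have := g_mono (x i) (x j); rewrite /h /e; lra.
(* The pinning term compares node [ord0] with the target [y], where both [e] and [h] would be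
   zero. *)
have h0 : 0 <= e ord0 * h ord0.
  by have := g_mono (x ord0) y; rewrite /h /e; lra.
have L0 := @laplacian_monotone_form_le0 _ _ _ _ _ Asym Aoff Arow mono.
have := mulr_ge0 eps0 h0.
pose w : 'rV[R]_m.+1 := \row_i e i.
have := @sym_quad_form_le _ _ _ _ _ w Msym l_inj l_eigen l_le.
have wE i : w ord0 i = e i by rewrite mxE.
have -> : (w *m pinned_matrix A eps *m w^T) ord0 ord0 =
    \sum_i e i * \sum_j pinned_matrix A eps i j * e j.
  rewrite -mulmxA mxE; apply: eq_bigr => i _; rewrite wE; congr (_ * _).
  by rewrite mxE; apply: eq_bigr => j _; rewrite [w^T _ _]mxE wE.
have -> : (w *m w^T) ord0 ord0 = \sum_i (x i - y) ^+ 2.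
  by rewrite dot_rowE; apply: eq_bigr => i _; rewrite wE -expr2.
move=> /(ler_wpM2l alpha0); rewrite mulrA; lra.
Qed.

(** * Derivatives of coordinates and exponential decay *)

Lemma has_derivative_at_coord (R : realType) (n : nat) (x : R -> 'cV[R]_n)
    (t : R) (v : 'cV[R]_n) (k : 'I_n) :
  0 < t -> has_derivative_at x t v ->
  is_derive t 1 (fun u => x u k ord0) (v k ord0).
Proof.
move=> t0 xv.
pose q u := ((u - t)^-1 *: (x u - x t)) k ord0.
have q_cvg : q u @[u --> t^'] --> v k ord0.
  apply: (@cvg_comp _ _ _ (fun u : R => (u - t)^-1 *: (x u - x t))
    (fun M : 'cV[R]_n => M k ord0)); last exact: coord_continuous.
  apply: cvg_trans xv; apply: cvg_fmap2 => P.
  have t_pos : \forall u \near t^', u \in `[0, +oo[.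
    apply: nbhs_dnbhs; apply: filterS (lt_nbhsr t0) => u /ltW.
    by rewrite in_itv/= andbT.
  by apply: filterS2 t_pos => u u0; apply.
have shift_cvg : h + t @[h --> 0^'] --> t^'.
  move=> P tP; have : \forall u \near t, u != t -> P u by [].
  rewrite (near_shift 0) subr0; apply: filterS => h /= hP h0; apply: hP.
  by rewrite -subr_eq0 addrK.
have dq : h^-1 *: (x (h *: 1 + t) k ord0 - x t k ord0) @[h --> 0^'] --> v k ord0.
  apply: cvg_trans (cvg_comp _ _ shift_cvg q_cvg).
  apply: near_eq_cvg; near=> h.
  by rewrite /q/= !mxE addrK [h%:A]mulr1.
apply: DeriveDef; first by apply/cvg_ex; exists (v k ord0).
exact: cvg_lim dq.
Unshelve. all: by end_near. Qed.

(** Gronwall argument: V(t) exp(r t) has derivative (V' + r V) exp(r t) <= 0, hence does not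
    increase. *)
Lemma exp_decay_of_deriv_le (R : realType) (V dV : R -> R) (a r : R) :
  (forall t, a <= t -> is_derive t 1 V (dV t)) ->
  (forall t, a <= t -> dV t <= - r * V t) ->
  forall t, a <= t -> V t <= V a * expR (r * a) * expR (- r * t).
Proof.
move=> V_der V_le t at_.
pose W u := V u * expR (r * u).
have W_der u : a <= u -> is_derive u 1 W ((dV u + r * V u) * expR (r * u)).
  move=> au; have := V_der _ au => ?.
  apply: is_derive_eq.
  by rewrite /GRing.scale/=; ring.
suff : W t <= W a.
  by rewrite /W mulNr expRN ler_pdivlMr ?expR_gt0.
have W_decr : {in `[a, t] &, {homo W : u v /~ u <= v}}.
  apply: ler0_derive1_le_cc => [u|u|].
  - by rewrite in_itv/= => /andP[/ltW au _]; have [] := W_der u au.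
  - rewrite in_itv/= => /andP[/ltW au _]; rewrite derive1E.
    have -> := @derive_val _ _ _ _ _ _ _ (W_der u au).
    by rewrite pmulr_lle0 ?expR_gt0//; have := V_le u au; lra.
  - apply: derivable_within_continuous => u; rewrite in_itv/= => /andP[au _].
    by have [] := W_der u au.
by apply: W_decr => //; rewrite in_itv/= lexx at_.
Qed.

(** * The network and the Lyapunov estimate in coordinates *)

Lemma network_field_coord (R : realType) (n m : nat)
    (f : 'cV[R]_n -> R -> 'cV[R]_n) (A : 'M[R]_m.+1) (c eps : R) (g : R -> R)
    (s : R -> 'cV[R]_n) (X : 'I_m.+1 -> 'cV[R]_n) (t : R) (i : 'I_m.+1)
    (k : 'I_n) :
  (forall i, \sum_j A i j = 0) ->
  network_field f A c eps g s X t i k ord0 =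
  f (X i) t k ord0 +
  c * \sum_j pinned_matrix A eps i j * (g (X j k ord0) - g (s t k ord0)).
Proof.
move=> Arow; rewrite pinned_sum.
(* By the zero row sums g(s) cancels from the sum over [A]; it survives only in the corner term,
   which is the pinning feedback. *)
have -> : \sum_j A i j * (g (X j k ord0) - g (s t k ord0)) =
    \sum_j A i j * g (X j k ord0).
  under eq_bigr do rewrite mulrBr.
  by rewrite sumrB -mulr_suml Arow mul0r subr0.
have sumE : (\sum_j A i j *: map_mx g (X j)) k ord0 = \sum_j A i j * g (X j k ord0).
  by rewrite summxE; apply: eq_bigr => j _; rewrite !mxE.
rewrite /network_field; case: eqVneq => [i0|_]; rewrite ![in LHS]mxE sumE.
  by rewrite -i0; ring.
by rewrite subr0.
Qed.

Lemma weighted_formE (R : realType) (n : nat) (p : 'rV[R]_n) (v w : 'cV[R]_n) :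
  (v^T *m diag_mx p *m w) ord0 ord0 =
  \sum_k p ord0 k * (v k ord0 * w k ord0).
Proof.
rewrite mul_mx_diag mxE; apply: eq_bigr => k _; rewrite !mxE; ring.
Qed.

(** The norm on column vectors is the maximum norm, so entrywise bounds suffice; squares are what
    the Lyapunov function controls. *)
Lemma mx_norm_le_of_sqr (R : realType) (n : nat) (v : 'cV[R]_n) (b : R) :
  0 <= b -> (forall k, v k ord0 ^+ 2 <= b ^+ 2) -> `|v| <= b.
Proof.
move=> b0 vb; change (mx_norm v <= b); rewrite mx_normrE.
apply: bigmax_le => // -[k j] _ /=; rewrite (ord1 j).
by rewrite -(ler_pXn2r (n := 2)) ?nnegrE// real_normK ?num_real.
Qed.

(** Adding and subtracting d_k e_ik^2 separates two effects: the condition on f is used node by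
    node, the coupling bound coordinate by coordinate, where d_k + c b <= 0 makes the remainder
    nonpositive. In the application D is f(x_i) - f(s), Q the coupling and b = alpha lambda_1. *)
Lemma lyapunov_dissipation (F : realFieldType) (m n : nat)
    (e D Q : 'I_m -> 'I_n -> F) (p d : 'I_n -> F) (c b eta : F) :
  0 <= c -> (forall k, 0 <= p k) -> (forall k, d k + c * b <= 0) ->
  (forall i, \sum_k p k * (e i k * (D i k - d k * e i k)) <=
             - eta * \sum_k e i k ^+ 2) ->
  (forall k, \sum_i e i k * Q i k <= b * \sum_i e i k ^+ 2) ->
  \sum_i \sum_k p k * (e i k * (D i k + c * Q i k)) <=
  - eta * \sum_i \sum_k e i k ^+ 2.
Proof.
move=> c0 p0 db0 D_le Q_le.
have -> : \sum_i \sum_k p k * (e i k * (D i k + c * Q i k)) =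
    \sum_i \sum_k p k * (e i k * (D i k - d k * e i k)) +
    \sum_k p k * (d k * (\sum_i e i k ^+ 2) + c * \sum_i e i k * Q i k).
  have -> : \sum_k p k * (d k * (\sum_i e i k ^+ 2) + c * \sum_i e i k * Q i k) =
      \sum_i \sum_k p k * (d k * e i k ^+ 2 + c * (e i k * Q i k)).
    rewrite exchange_big; apply: eq_bigr => k _ /=.
    by rewrite !mulr_sumr -big_split mulr_sumr.
  rewrite -big_split; apply: eq_bigr => i _ /=.
  by rewrite -big_split; apply: eq_bigr => k _ /=; ring.
rewrite -[leRHS]addr0; apply: lerD; first by rewrite mulr_sumr ler_sum.
apply: sumr_le0 => k _; apply: mulr_ge0_le0 => //.
have S0 : 0 <= \sum_i e i k ^+ 2 by apply: sumr_ge0 => i _; apply: sqr_ge0.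
have := ler_wpM2l c0 (Q_le k); have := mulr_le0_ge0 (db0 k) S0; lra.
Qed.

Lemma is_derive_fun_sum (R : realType) (n : nat) (h : 'I_n -> R -> R) (t : R)
    (dh : 'I_n -> R) :
  (forall i, is_derive t 1 (h i) (dh i)) ->
  is_derive t 1 (fun u => \sum_i h i u) (\sum_i dh i).
Proof.
move=> h_der; rewrite (_ : (fun _ => _) = \sum_i h i); first exact: is_derive_sum.
by apply/funext => u; rewrite fct_sumE.
Qed.

(** * Exponential synchronization *)

Theorem theorem4 (R : realType) (n m : nat)
    (f : 'cV[R]_n -> R -> 'cV[R]_n)
    (f_cont : {within [set z : 'cV[R]_n * R | 0 <= z.2],
                 continuous (fun z => f z.1 z.2)})
    (s : R -> 'cV[R]_n) (s_sol : is_solution f s)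
    (A : 'M[R]_m.+1)
    (A_sym : A^T = A)
    (A_offdiag : forall i j, i != j -> 0 <= A i j)
    (A_rowsum : forall i, \sum_j A i j = 0)
    (c eps : R) (c_gt0 : 0 < c) (eps_gt0 : 0 < eps)
    (lambda : 'I_m.+1 -> R)
    (lambda_lt0 : forall i, lambda i < 0)
    (lambda_decr : forall i j : 'I_m.+1, (i < j)%N -> lambda j < lambda i)
    (lambda_eigen : forall a : R,
       eigenvalue (pinned_matrix A eps) a <-> exists i, a = lambda i)
    (g : R -> R) (alpha : R)
    (g_incr : {homo g : u v / u < v})
    (alpha_gt0 : 0 < alpha)
    (g_slope : forall u v, u != v -> alpha <= (g u - g v) / (u - v))
    (p d : 'rV[R]_n) (eta : R)
    (p_gt0 : forall k, 0 < p ord0 k)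
    (d_gt0 : forall k, 0 < d ord0 k)
    (eta_gt0 : 0 < eta)
    (f_quad : forall (x y : 'cV[R]_n) (t : R), 0 <= t ->
       ((x - y)^T *m diag_mx p *m
          (f x t - diag_mx d *m x - f y t + diag_mx d *m y)) ord0 ord0
       <= - eta * ((x - y)^T *m (x - y)) ord0 ord0)
    (gain : forall k, d ord0 k + alpha * c * lambda ord0 < 0) :
  globally_exp_synchronized
    (@is_network_solution R n m f A c eps g s) s.
Proof.
have l_inj : injective lambda.
  move=> i j lij; apply/val_inj; case: (ltngtP i j) => //.
    by move=> /lambda_decr; rewrite lij ltxx.
  by move=> /lambda_decr; rewrite lij ltxx.
have l_eigen i : eigenvalue (pinned_matrix A eps) (lambda i).
  by apply/lambda_eigen; exists i.
have l_le i : lambda i <= lambda ord0.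
  have [->//|i0] := eqVneq i ord0.
  by apply/ltW/lambda_decr; rewrite lt0n.
have g_mono u v : alpha * (u - v) ^+ 2 <= (u - v) * (g u - g v).
  have [->|uv] := eqVneq u v; first by rewrite !subrr expr0n mulr0 mul0r.
  have uv0 : u - v != 0 by rewrite subr_eq0.
  have := ler_wpM2r (sqr_ge0 (u - v)) (g_slope u v uv).
  by congr (_ <= _); field.
(* [pmax] and [qmax] bound all p_k and all 1/p_k, making V comparable with |e|^2; the summand 1
   keeps [pmax] positive even for n = 0. *)
pose pmax := 1 + \sum_k p ord0 k.
pose qmax := \sum_k (p ord0 k)^-1.
have p_ge0 k : 0 <= p ord0 k by exact: ltW.
have q_ge0 k : 0 <= (p ord0 k)^-1 by rewrite invr_ge0.
have pmax_gt0 : 0 < pmax by rewrite ltr_pwDl// sumr_ge0.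
have p_le k : p ord0 k <= pmax.
  by rewrite /pmax (bigD1 k)//= ler_wpDl// lerDl sumr_ge0.
have q_le k : (p ord0 k)^-1 <= qmax by rewrite /qmax (bigD1 k)//= lerDl sumr_ge0.
(* From V' <= - 2 eta |e|^2 and V <= pmax |e|^2 one gets V' <= - r V. As V is quadratic in the
   error, the error decays at rate r/2, whatever the solution. *)
pose r := 2 * eta / pmax.
have r_gt0 : 0 < r by rewrite divr_gt0// mulr_gt0.
exists (r / 2); first by rewrite divr_gt0.
move=> x x_sol.
pose e i k u := x i u k ord0 - s u k ord0.
pose F i t := network_field f A c eps g s (x ^~ t) t i.
pose V u := \sum_i \sum_k p ord0 k * e i k u ^+ 2.
pose dV u := \sum_i \sum_k p ord0 k *
  (2 * (e i k u * (F i u k ord0 - f (s u) u k ord0))).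
have V_der (t : R) : 1 <= t -> is_derive t 1 V (dV t).
  move=> t1; have t0 : 0 < t by apply: lt_le_trans t1.
  apply: is_derive_fun_sum => i; apply: is_derive_fun_sum => k.
  have dx := has_derivative_at_coord _ _ _ _ _ k t0 (x_sol t (ltW t0) i).
  have ds := has_derivative_at_coord _ _ _ _ _ k t0 (s_sol t (ltW t0)).
  apply: is_derive_eq; rewrite /GRing.scale/= /e /F.
  by rewrite mulr1 -mulr2n mulr_natl.
have dV_le (t : R) : 1 <= t -> dV t <= - r * V t.
  move=> t1; have t0 : 0 <= t by apply: le_trans t1.
  have diss : \sum_i \sum_k p ord0 k * (e i k t *
      ((f (x i t) t k ord0 - f (s t) t k ord0) + c * \sum_j
        pinned_matrix A eps i j * (g (x j t k ord0) - g (s t k ord0)))) <=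
      - eta * \sum_i \sum_k e i k t ^+ 2.
    apply: (@lyapunov_dissipation _ _ _ (fun i k => e i k t)
      (fun i k => f (x i t) t k ord0 - f (s t) t k ord0) _
      (p ord0) (d ord0) _ (alpha * lambda ord0)) => [||k|i|k].
    - exact: ltW.
    - by [].
    - have := gain k; lra.
    - have := f_quad (x i t) (s t) t t0; rewrite weighted_formE.
      congr (_ <= _).
        by apply: eq_bigr => k _; rewrite !mul_diag_mx !mxE /e !ord1; ring.
      by congr (_ * _); rewrite mxE; apply: eq_bigr => k _; rewrite !mxE -expr2.
    - exact: (pinned_coupling_le _ _ _ _ _ _ _ _ (fun i => x i t k ord0) (s t k ord0)
        A_sym A_offdiag A_rowsum (ltW eps_gt0) l_inj l_eigen l_le
        (ltW alpha_gt0) g_mono).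
  have -> : dV t = 2 * \sum_i \sum_k p ord0 k * (e i k t *
      ((f (x i t) t k ord0 - f (s t) t k ord0) + c * \sum_j
        pinned_matrix A eps i j * (g (x j t k ord0) - g (s t k ord0)))).
    rewrite mulr_sumr; apply: eq_bigr => i _; rewrite mulr_sumr.
    by apply: eq_bigr => k _; rewrite /F network_field_coord//; ring.
  have V_le : V t <= pmax * \sum_i \sum_k e i k t ^+ 2.
    rewrite mulr_sumr; apply: ler_sum => i _; rewrite mulr_sumr.
    by apply: ler_sum => k _; rewrite ler_wpM2r ?sqr_ge0.
  have rV_le := ler_wpM2l (ltW r_gt0) V_le.
  have rpmax : r * pmax = 2 * eta by rewrite /r divfK// gt_eqF.
  move: rV_le; rewrite mulrA rpmax; lra.
(* Times before 1 are irrelevant at infinity; starting at 1 keeps to times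
   where the one-sided derivative of the definition is two-sided. *)
have V_decay := exp_decay_of_deriv_le _ _ _ _ _ V_der dV_le.
have V_ge0 u : 0 <= V u.
  by apply: sumr_ge0 => i _; apply: sumr_ge0 => k _; rewrite mulr_ge0// sqr_ge0.
(* Each squared error is at most V / p_k, hence at most K exp(- r t) for t >= 1. *)
move=> i; pose K := qmax * (V 1 * expR (r * 1)).
have K_ge0 : 0 <= K.
  by rewrite mulr_ge0 ?sumr_ge0// mulr_ge0// expR_ge0.
(* The constant 1 + K replaces the square root of K: it is positive and K <= (1 + K)^2. *)
exists (1 + K); first by rewrite ltr_pwDl.
near=> t; have t1 : 1 <= t by near: t; exact: nbhs_pinfty_ge.
apply: mx_norm_le_of_sqr => [|k]; first by rewrite mulr_ge0 ?expR_ge0// addr_ge0.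
have -> : (x i t - s t) k ord0 = e i k t by rewrite !mxE.
have e_le : e i k t ^+ 2 <= qmax * V t.
  have pe_le : p ord0 k * e i k t ^+ 2 <= V t.
    rewrite /V (bigD1 i)//= (bigD1 k)//= -addrA lerDl addr_ge0 ?sumr_ge0//.
      by move=> l _; rewrite mulr_ge0// sqr_ge0.
    by move=> j _; apply: sumr_ge0 => l _; rewrite mulr_ge0// sqr_ge0.
  rewrite -[leLHS](mulKf (lt0r_neq0 (p_gt0 k))).
  by apply: (le_trans (ler_wpM2l (q_ge0 k) pe_le)); rewrite ler_wpM2r.
apply: (le_trans e_le).
apply: (@le_trans _ _ (K * expR (- r * t))).
  by rewrite /K -mulrA ler_wpM2l ?sumr_ge0// V_decay.
rewrite exprMn; have -> : expR (- (r / 2) * t) ^+ 2 = expR (- r * t).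
  by rewrite -expRM_natl; congr expR; field.
rewrite ler_wpM2r ?expR_ge0//; nra.
Unshelve. all: by end_near. Qed.
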